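(* Let $(X,\mathcal{T})$ be a topological space and let $\varphi\colon \mathbb{R}^+\times X\to X$ be a semi-flow. A subset $U\subset X$ is a closed attracting block for $\varphi$ if and only if $U$ is closed in $\mathcal{T}$ and open in the block-flow topology $\mathcal{T}^-_\bullet$ of $\varphi$ (i.e. $U$ is a $(\mathcal{T},\mathcal{T}^-_\bullet)$-pairwise clopen set in the bi-topological space $(X,\mathcal{T},\mathcal{T}^-_\bullet)$).
   Context: A semi-flow on $(X,\mathcal{T})$ is a continuous map $\varphi\colon\mathbb{R}^+\times X\to X$, $\mathbb{R}^+=[0,\infty)$, with $\varphi(0,x)=x$ and $\varphi(t,\varphi(s,x))=\varphi(t+s,x)$. For $t>0$ put $\varphi(-t,U)=\{x\in X\mid \varphi(t,x)\in U\}$. Closure $\mathrm{cl}$ and interior $\mathrm{int}$ are with respect to $\mathcal{T}$. A closed attracting block is a set $U\subset X$ with $\mathrm{cl}\,U=U$ and $\varphi(t,U)\subset \mathrm{int}\,U$ for all $t>0$. Define $\Gamma^-U=\bigcup_{t>0}\varphi(-t,U)$ and $\Gamma^-_\bullet U=\Gamma^-(\mathrm{cl}\,U)$. The block-flow topology $\mathcal{T}^-_\bullet$ on $X$ is the topology whose closed sets are exactly the sets $U\subset X$ with $\Gamma^-_\bullet U\subset U$. *)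

(* Defs.v *)
From HB Require Import structures.
From mathcomp Require Import all_boot all_order all_algebra.
From mathcomp Require Import all_classical all_reals all_analysis.

Set Implicit Arguments.
Unset Strict Implicit.
Unset Printing Implicit Defensive.

Import Order.TTheory GRing.Theory Num.Theory.
Import numFieldTopology.Exports.
Local Open Scope classical_set_scope.
Local Open Scope ring_scope.

(* A semi-flow [0, +oo[ * X -> X is represented by a total function on R,
   constrained only at nonnegative times; its values at negative times are
   never used.  Continuity is with respect to the subspace topology of
   [0, +oo[ * X in the product R * X. *)
Record is_semiflow (R : realType) (X : topologicalType) (phi : R -> X -> X)
    : Prop := IsSemiflow {
  semiflow_continuous :
    {within [set p : R * X | 0 <= p.1], continuous (fun p => phi p.1 p.2)};
  semiflow0 : forall x, phi 0 x = x;
  semiflowD : forall t s x, 0 <= t -> 0 <= s ->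
    phi t (phi s x) = phi (t + s) x
}.

Definition closed_attracting_block (R : realType) (X : topologicalType)
    (phi : R -> X -> X) (U : set X) : Prop :=
  closure U = U /\ forall t, 0 < t -> phi t @` U `<=` U^°.

Definition Gamma_minus (R : realType) (X : Type) (phi : R -> X -> X)
    (U : set X) : set X :=
  \bigcup_(t in [set t : R | 0 < t]) (phi t @^-1` U).

Definition Gamma_minus_block (R : realType) (X : topologicalType)
    (phi : R -> X -> X) (U : set X) : set X :=
  Gamma_minus phi (closure U).

(* The carrier X with the block-flow topology of phi instead of its own
   topology. *)
Definition block_flow (R : realType) (X : topologicalType)
    (phi : R -> X -> X) : Type := X.

Section BlockFlowTopology.
Context (R : realType) (X : topologicalType) (phi : R -> X -> X).

Definition block_flow_closed (U : set X) : Prop :=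
  Gamma_minus_block phi U `<=` U.

Definition block_flow_open (U : set (block_flow phi)) : Prop :=
  block_flow_closed (~` U).

Lemma block_flow_openT : block_flow_open setT.
Proof.
rewrite /block_flow_open /block_flow_closed setCT.
by rewrite /Gamma_minus_block closure0 => x [t _].
Qed.

Lemma block_flow_openI : setI_closed block_flow_open.
Proof.
move=> A B oA oB x [t t0]; rewrite setCI closureU => -[cA|cB].
  by left; apply: oA; exists t.
by right; apply: oB; exists t.
Qed.

Lemma block_flow_open_bigU (I : Type) (f : I -> set (block_flow phi)) :
  (forall i, block_flow_open (f i)) -> block_flow_open (\bigcup_i f i).
Proof.
move=> fo x [t t0 cx] [i _ fix_]; apply: (fo i x) fix_; exists t => //.
by apply: closure_subset cx => y nfy fiy; apply: nfy; exists i.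
Qed.

HB.instance Definition _ := Choice.on (block_flow phi).
HB.instance Definition _ := isOpenTopological.Build (block_flow phi)
  block_flow_openT block_flow_openI block_flow_open_bigU.

Lemma closed_block_flowE (U : set (block_flow phi)) :
  closed U <-> Gamma_minus_block phi U `<=` U.
Proof. by rewrite -openC /open /= /block_flow_open setCK. Qed.

End BlockFlowTopology.

(* Main.v *)
Require Import Defs.
From HB Require Import structures.
From mathcomp Require Import all_boot all_order all_algebra.
From mathcomp Require Import all_classical all_reals all_analysis.

Local Open Scope classical_set_scope.
Local Open Scope ring_scope.

(* By duality [closure (~` U) = ~` U°], block-flow openness of [U] is the
   contrapositive of [phi t @` U `<=` U°] for all positive [t]. *)
Lemma block_flow_openE (R : realType) (X : topologicalType)
    (phi : R -> X -> X) (U : set X) :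
  @open (block_flow phi) U <-> forall t, 0 < t -> phi t @` U `<=` U°.
Proof.
(* Holds by conversion; the closure inside [Gamma_minus_block] is that of [X], not of
   [block_flow phi]. *)
rewrite [open _]/(Gamma_minus_block phi (~` U) `<=` ~` U).
rewrite /Gamma_minus_block closure_setC.
split=> [oU t t0 _ [x Ux <-]|aU x [t t0 nU] Ux].
  by apply: contrapT => nU; apply: (oU x) Ux; exists t.
by apply: nU; apply: (aU t t0); exists x.
Qed.

Theorem theorem3p8 (R : realType) (X : topologicalType) (phi : R -> X -> X)
    (phi_semiflow : is_semiflow phi) (U : set X) :
  closed_attracting_block phi U <->
  @closed X U /\ @open (block_flow phi) U.
Proof.
rewrite block_flow_openE; split=> -[cU aU]; split=> //.
  by apply/closure_id.
by apply/esym/closure_id.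
Qed.
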